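(* Let $A\subseteq\mathbb N$ be a maximal set and let $B\subsetneq A$ be a c.e. set. Then $E_A^+<E_B^+$. In particular, $E_A$ is not high for the computable FS-jump.
   Context: $\phi_e$ is the $e$-th partial computable function, $W_e$ its domain. A c.e. set $A$ is maximal if $A^c$ is infinite and for every c.e. set $W$, either $W\setminus A$ or $W^c\setminus A$ is finite. $E_A$ is the equivalence relation with $m\mathrel{E_A}n$ iff $m=n$ or $m,n\in A$. The computable FS-jump is $E^+$ with $e\mathrel{E^+}e'$ iff $\{[\phi_e(n)]_E:\phi_e(n)\downarrow\}=\{[\phi_{e'}(n)]_E:\phi_{e'}(n)\downarrow\}$. $E\leq F$ means there is a total computable $f$ with $x\mathrel{E}y\iff f(x)\mathrel{F}f(y)$; $E<F$ means $E\leq F$ and $F\not\leq E$. $=^{ce}$ is $e=^{ce}e'$ iff $W_e=W_{e'}$. A ceer $E$ is high for the computable FS-jump if $E^+$ is computably bireducible with $=^{ce}$. *)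

(* Defs.v *)
From mathcomp Require Import all_boot.
From mathcomp Require Import boolp classical_sets cardinality.
From mathcomp Require Import zify.
From Stdlib Require Import Arith.Cantor.

Set Implicit Arguments.
Unset Strict Implicit.
Unset Printing Implicit Defensive.

Local Open Scope classical_set_scope.

(** Unary partial recursive functions; tuples are coded by the Cantor bijection
    between pairs of naturals and naturals. *)
Definition npair (x y : nat) : nat := Cantor.to_nat (x, y).
Definition nleft (n : nat) : nat := (Cantor.of_nat n).1.
Definition nright (n : nat) : nat := (Cantor.of_nat n).2.

Inductive code : Type :=
  | Zero
  | Succ
  | Left
  | Right
  | Pair of code & code
  | Comp of code & code
  | Prec of code & code
  | Mu of code.

(** [prec_graph F G a n y]: the function h(a, 0) = F(a),
    h(a, n + 1) = G(<a, <n, h(a, n)>>) is defined at (a, n) with value y. *)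
Fixpoint prec_graph (F G : nat -> nat -> Prop) (a n y : nat) : Prop :=
  match n with
  | 0 => F a y
  | m.+1 => exists2 z, prec_graph F G a m z & G (npair a (npair m z)) y
  end.

Fixpoint eval (c : code) (x y : nat) : Prop :=
  match c with
  | Zero => y = 0
  | Succ => y = x.+1
  | Left => y = nleft x
  | Right => y = nright x
  | Pair f g => exists u v, [/\ eval f x u, eval g x v & y = npair u v]
  | Comp f g => exists2 z, eval g x z & eval f z y
  | Prec f g => prec_graph (eval f) (eval g) (nleft x) (nright x) y
  | Mu f => eval f (npair x y) 0 /\
            (forall k, k < y -> exists z, eval f (npair x k) z.+1)
  end.

Fixpoint encode (c : code) : nat :=
  match c with
  | Zero => 0
  | Succ => 1
  | Left => 2
  | Right => 3
  | Pair f g => 4 + 4 * npair (encode f) (encode g)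
  | Comp f g => 5 + 4 * npair (encode f) (encode g)
  | Prec f g => 6 + 4 * npair (encode f) (encode g)
  | Mu f => 7 + 4 * encode f
  end.

(** [phi e n y]: the [e]-th partial computable function is defined at [n], with
    value [y].  By [encode_inj] and [encode_surj] below, every [e] is the number
    of exactly one program. *)
Definition phi (e n y : nat) : Prop := exists2 c, encode c = e & eval c n y.

Definition W (e : nat) : set nat := [set n | exists y, phi e n y].

Definition computable (f : nat -> nat) : Prop :=
  exists e, forall n, phi e n (f n).

Definition ce (X : set nat) : Prop := exists e, X = W e.

Definition maximal (A : set nat) : Prop :=
  [/\ ce A, infinite_set (~` A) &
    forall X : set nat, ce X ->
      finite_set (X `\` A) \/ finite_set (~` X `\` A)].

Definition eqrel_of (A : set nat) (m n : nat) : Prop := m = n \/ (A m /\ A n).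

Definition eqclass (E : nat -> nat -> Prop) (x : nat) : set nat :=
  [set z | E x z].

Definition class_set (E : nat -> nat -> Prop) (e : nat) : set (set nat) :=
  [set C | exists n y, phi e n y /\ C = eqclass E y].

Definition fs_jump (E : nat -> nat -> Prop) (e e' : nat) : Prop :=
  class_set E e = class_set E e'.

Definition reducible (E F : nat -> nat -> Prop) : Prop :=
  exists f : nat -> nat,
    computable f /\ (forall x y, E x y <-> F (f x) (f y)).

Definition strictly_reducible (E F : nat -> nat -> Prop) : Prop :=
  reducible E F /\ ~ reducible F E.

Definition bireducible (E F : nat -> nat -> Prop) : Prop :=
  reducible E F /\ reducible F E.

Definition eqce (e e' : nat) : Prop := W e = W e'.

Definition high_for_fs_jump (E : nat -> nat -> Prop) : Prop :=
  bireducible (fs_jump E) eqce.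

Lemma npair_inj x y x' y' : npair x y = npair x' y' -> x = x' /\ y = y'.
Proof.
move=> h; have := congr1 Cantor.of_nat h.
by rewrite /npair !Cantor.cancel_of_to => -[-> ->].
Qed.

Lemma nleftK x y : nleft (npair x y) = x.
Proof. by rewrite /nleft /npair Cantor.cancel_of_to. Qed.

Lemma nrightK x y : nright (npair x y) = y.
Proof. by rewrite /nright /npair Cantor.cancel_of_to. Qed.

Lemma npairK n : npair (nleft n) (nright n) = n.
Proof. by rewrite /npair /nleft /nright -surjective_pairing Cantor.cancel_to_of. Qed.

Lemma npair_ge x y : x + y <= npair x y.
Proof. have := Cantor.to_nat_non_decreasing x y; rewrite /npair; lia. Qed.

Lemma encode_inj : injective encode.
Proof.
elim=> [||||f IHf g IHg|f IHf g IHg|f IHf g IHg|f IHf]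
  [||||f' g'|f' g'|f' g'|f'] //= h; try lia.
- by have /npair_inj[/IHf-> /IHg->] :
    npair (encode f) (encode g) = npair (encode f') (encode g') by lia.
- by have /npair_inj[/IHf-> /IHg->] :
    npair (encode f) (encode g) = npair (encode f') (encode g') by lia.
- by have /npair_inj[/IHf-> /IHg->] :
    npair (encode f) (encode g) = npair (encode f') (encode g') by lia.
- by have /IHf-> : encode f = encode f' by lia.
Qed.

Lemma encode_surj e : exists c, encode c = e.
Proof.
have [k] := ubnP e; elim: k e => // k IH e lt_ek.
case: e lt_ek => [|[|[|[|m]]]] lt_mk; [by exists Zero | by exists Succ
  | by exists Left | by exists Right |].
have ge_q := npair_ge (nleft (m %/ 4)) (nright (m %/ 4)).
rewrite npairK in ge_q.
have [|f hf] := IH (nleft (m %/ 4)); first by lia.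
have [|g hg] := IH (nright (m %/ 4)); first by lia.
have [|h hh] := IH (m %/ 4); first by lia.
have : m %% 4 < 4 by rewrite ltn_mod.
have := divn_eq m 4; case: (m %% 4) => [|[|[|[|//]]]] eq_m _.
- by exists (Pair f g); rewrite /= hf hg npairK; lia.
- by exists (Comp f g); rewrite /= hf hg npairK; lia.
- by exists (Prec f g); rewrite /= hf hg npairK; lia.
- by exists (Mu h); rewrite /= hh; lia.
Qed.

Lemma eval_fun c x y y' : eval c x y -> eval c x y' -> y = y'.
Proof.
elim: c x y y' => [||||f IHf g IHg|f IHf g IHg|f IHf g IHg|f IHf] x y y' /=;
  try by move=> -> ->.
- move=> [u [v [fu gv ->]]] [u' [v' [fu' gv' ->]]].
  by rewrite (IHf _ _ _ fu fu') (IHg _ _ _ gv gv').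
- by move=> [z gz fz] [z' /(IHg _ _ _ gz) <-]; apply: IHf.
- elim: (nright x) y y' => [|n IHn] y y' /=; first exact: IHf.
  by move=> [z hz gz] [z' /(IHn _ _ hz) <-]; apply: IHg.
- move=> [f0 fS] [f0' fS']; case: (ltngtP y y') => // lt_y.
  + by have [z /(IHf _ _ _ f0)] := fS' _ lt_y.
  + by have [z /(IHf _ _ _ f0')] := fS _ lt_y.
Qed.

Lemma phi_fun e n y y' : phi e n y -> phi e n y' -> y = y'.
Proof. by move=> [c <- h] [c' /encode_inj-> h']; apply: eval_fun h h'. Qed.

(* Main.v *)
Require Import Defs.
From mathcomp Require Import all_boot.
From mathcomp Require Import boolp classical_sets cardinality.
From mathcomp Require Import zify.

(** Up to extensional equality, [fs_jump (eqrel_of A)] compares the [A]-saturations of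
    the ranges of the functions [phi e].

    If [B] is contained in [A], then [A]-saturated sets are [B]-saturated, so that
    passing from [e] to an index of the [A]-saturation of its range is a reduction.

    Conversely, a reduction of the jump of [B] to the jump of [A] induces an injection
    [F] of the [B]-saturated c.e. sets into the [A]-saturated ones, and the recursion
    theorem shows that [F] is monotone.  Choose [a] in [A] but not in [B].  The
    sequence [T_0 = N], [T_(n+1) = F (T_n \ a)] is uniformly c.e. and strictly
    decreasing; by saturation, its differences [T_n \ T_(n+1)] eventually meet the
    complement of [A].  A finite-injury argument then splits the complement of [A] into
    two infinite parts by a c.e. set, which contradicts maximality. *)

Set Implicit Arguments.
Unset Strict Implicit.
Unset Printing Implicit Defensive.

Local Open Scope classical_set_scope.

(** * Computable functions and decidable predicates *)

Lemma computableP f : computable f <-> exists c, forall x, eval c x (f x).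
Proof.
split=> [[e he]|[c hc]]; last by exists (encode c) => n; exists c.
have [c ec] := encode_surj e; exists c => x.
by have [c' + h] := he x; rewrite -ec => /encode_inj <-.
Qed.

Lemma eq_computable f g : f =1 g -> computable f -> computable g.
Proof. by move=> /funext ->. Qed.

Lemma computable_id : computable (fun x => x).
Proof.
by apply/computableP; exists (Pair Left Right) => x; exists (nleft x), (nright x);
  rewrite npairK.
Qed.

Lemma computable_comp f g :
  computable f -> computable g -> computable (fun x => f (g x)).
Proof.
move=> /computableP[c hc] /computableP[d hd]; apply/computableP.
by exists (Comp c d) => x; exists (g x).
Qed.

Lemma computable_succ g : computable g -> computable (fun x => (g x).+1).
Proof. by apply: (@computable_comp S); apply/computableP; exists Succ. Qed.

Lemma computable_const k : computable (fun=> k).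
Proof.
elim: k => [|k IH]; last exact: computable_succ.
by apply/computableP; exists Zero.
Qed.

Lemma computable_nleft g : computable g -> computable (fun x => nleft (g x)).
Proof. by apply: computable_comp; apply/computableP; exists Left. Qed.

Lemma computable_nright g : computable g -> computable (fun x => nright (g x)).
Proof. by apply: computable_comp; apply/computableP; exists Right. Qed.

Lemma computable_npair f g :
  computable f -> computable g -> computable (fun x => npair (f x) (g x)).
Proof.
move=> /computableP[c hc] /computableP[d hd]; apply/computableP.
by exists (Pair c d) => x; exists (f x), (g x).
Qed.

Fixpoint primrec (a : nat) (s : nat -> nat -> nat) (n : nat) : nat :=
  if n is m.+1 then s m (primrec a s m) else a.


(** [Prec] works on a parameter paired with a counter. The recursion is therefore built for an
    arbitrary counter, with [x] itself as parameter, and the counter [n x] is substituted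
    afterwards. *)
Lemma computable_primrec a s n :
    computable a ->
    computable (fun w => s (nleft w) (nleft (nright w)) (nright (nright w))) ->
    computable n ->
  computable (fun x => primrec (a x) (s x) (n x)).
Proof.
move=> /computableP[ca ha] /computableP[cs hs] hn.
pose F w := primrec (a (nleft w)) (s (nleft w)) (nright w).
suff hF : computable F.
  apply: eq_computable (computable_comp hF (computable_npair computable_id hn)).
  by move=> x; rewrite /F nleftK nrightK.
apply/computableP; exists (Prec ca cs) => w; rewrite /F /=.
elim: (nright w) => [|m IH] /=; first exact: ha.
exists (primrec (a (nleft w)) (s (nleft w)) m) => //.
set r := primrec _ _ m.
by have := hs (npair (nleft w) (npair m r)); rewrite !(nleftK, nrightK).
Qed.

Lemma computable_comp2 F f g :
    computable (fun w => F (nleft w) (nright w)) ->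
    computable f -> computable g ->
  computable (fun x => F (f x) (g x)).
Proof.
move=> hF hf hg; apply: eq_computable (computable_comp hF (computable_npair hf hg)).
by move=> x; rewrite nleftK nrightK.
Qed.

Lemma computable_add f g :
  computable f -> computable g -> computable (fun x => f x + g x).
Proof.
apply: computable_comp2.
apply: (@eq_computable (fun w => primrec (nleft w) (fun _ r => r.+1) (nright w))).
  by move=> w; elim: (nright w) => [|m /= ->]; rewrite ?addn0 ?addnS.
apply: computable_primrec.
- exact/computable_nleft/computable_id.
- exact/computable_succ/computable_nright/computable_nright/computable_id.
- exact/computable_nright/computable_id.
Qed.

Lemma computable_pred f : computable f -> computable (fun x => (f x).-1).
Proof.
apply: (@computable_comp predn).
apply: (@eq_computable (fun w => primrec 0 (fun m _ => m) w)); first by case.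
apply: computable_primrec; first exact: computable_const.
  exact/computable_nleft/computable_nright/computable_id.
exact: computable_id.
Qed.

Lemma computable_sub f g :
  computable f -> computable g -> computable (fun x => f x - g x).
Proof.
apply: computable_comp2.
apply: (@eq_computable (fun w => primrec (nleft w) (fun _ r => r.-1) (nright w))).
  by move=> w; elim: (nright w) => [|m /= ->]; rewrite ?subn0 ?subnS.
apply: computable_primrec.
- exact/computable_nleft/computable_id.
- exact/computable_pred/computable_nright/computable_nright/computable_id.
- exact/computable_nright/computable_id.
Qed.

Lemma computable_muln k f : computable f -> computable (fun x => k * f x).
Proof.
move=> hf; elim: k => [|k IH].
  by apply: eq_computable (computable_const 0) => x; rewrite mul0n.
by apply: eq_computable (computable_add hf IH) => x; rewrite mulSn.
Qed.

Definition decidable_pred (p : nat -> bool) : Prop :=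
  computable (fun x => nat_of_bool (p x)).

Lemma eq_decidable p q : p =1 q -> decidable_pred p -> decidable_pred q.
Proof. by move=> /funext ->. Qed.

Lemma computable_if p f g :
    decidable_pred p -> computable f -> computable g ->
  computable (fun x => if p x then f x else g x).
Proof.
move=> hp hf hg.
(* The test, read as 0 or 1, is the number of recursion steps: no step leaves [g x], one step
   returns [f x]. *)
apply: (@eq_computable (fun x => primrec (g x) (fun _ _ => f x) (p x))).
  by move=> x; case: (p x).
apply: computable_primrec => //.
exact/(computable_comp hf)/computable_nleft/computable_id.
Qed.

Lemma decidable_const b : decidable_pred (fun=> b).
Proof. exact: computable_const. Qed.

Lemma decidable_if p q r :
    decidable_pred p -> decidable_pred q -> decidable_pred r ->
  decidable_pred (fun x => if p x then q x else r x).
Proof.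
move=> hp hq hr; apply: eq_computable (computable_if hp hq hr) => x.
by case: (p x).
Qed.

Lemma decidable_neg p : decidable_pred p -> decidable_pred (fun x => ~~ p x).
Proof. by move=> hp; apply: decidable_if hp _ _; apply: decidable_const. Qed.

Lemma decidable_and p q :
  decidable_pred p -> decidable_pred q -> decidable_pred (fun x => p x && q x).
Proof. by move=> hp hq; apply: decidable_if hp hq _; apply: decidable_const. Qed.

Lemma decidable_or p q :
  decidable_pred p -> decidable_pred q -> decidable_pred (fun x => p x || q x).
Proof. by move=> hp hq; apply: decidable_if hp _ hq; apply: decidable_const. Qed.

Lemma decidable_comp p f :
  decidable_pred p -> computable f -> decidable_pred (fun x => p (f x)).
Proof. by move=> hp hf; apply: (computable_comp hp hf). Qed.

Lemma decidable_eq0 f : computable f -> decidable_pred (fun x => f x == 0).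
Proof.
move=> hf; apply: (@eq_computable (fun x => 1 - f x)).
  by move=> x; case: (f x).
exact/computable_sub/hf/computable_const.
Qed.

Lemma decidable_leq f g :
  computable f -> computable g -> decidable_pred (fun x => f x <= g x).
Proof. by move=> hf hg; apply/decidable_eq0/computable_sub. Qed.

Lemma decidable_eq f g :
  computable f -> computable g -> decidable_pred (fun x => f x == g x).
Proof.
move=> hf hg; apply: (@eq_decidable (fun x => (f x <= g x) && (g x <= f x))).
  by move=> x; rewrite -eqn_leq.
by apply: decidable_and; apply: decidable_leq.
Qed.

Lemma has_iotaS p n : has p (iota 0 n.+1) = p n || has p (iota 0 n).
Proof. by rewrite -addn1 iotaD has_cat /= orbF orbC. Qed.

Lemma has_iotaP (p : nat -> bool) n :
  reflect (exists2 i, i < n & p i) (has p (iota 0 n)).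
Proof.
apply: (iffP hasP) => -[i]; first by rewrite mem_iota => /andP[_ lt_in]; exists i.
by exists i; rewrite // mem_iota.
Qed.

Lemma all_iotaP (p : nat -> bool) n :
  reflect (forall i, i < n -> p i) (all p (iota 0 n)).
Proof.
apply: (iffP allP) => h i; last by rewrite mem_iota => /andP[_ /h].
by move=> lt_in; apply: h; rewrite mem_iota.
Qed.

Lemma decidable_has (p : nat -> nat -> bool) n :
    decidable_pred (fun w => p (nleft w) (nright w)) -> computable n ->
  decidable_pred (fun x => has (p x) (iota 0 (n x))).
Proof.
move=> hp hn; pose s x m r := if p x m then 1 else r.
apply: (@eq_computable (fun x => primrec 0 (s x) (n x))).
  move=> x; elim: (n x) => // m IH; rewrite has_iotaS /= IH /s.
  by case: (p x m).
apply: computable_primrec => //; first exact: computable_const.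
apply: computable_if; last exact/computable_nright/computable_nright/computable_id.
  have h : computable (fun w => npair (nleft w) (nleft (nright w))).
    apply: computable_npair; first exact/computable_nleft/computable_id.
    exact/computable_nleft/computable_nright/computable_id.
  apply: eq_decidable (decidable_comp hp h) => w.
  by rewrite nleftK nrightK.
exact: computable_const.
Qed.

Lemma decidable_all (p : nat -> nat -> bool) n :
    decidable_pred (fun w => p (nleft w) (nright w)) -> computable n ->
  decidable_pred (fun x => all (p x) (iota 0 (n x))).
Proof.
move=> hp hn.
apply: (@eq_decidable (fun x => ~~ has (fun i => ~~ p x i) (iota 0 (n x)))).
  by move=> x; rewrite -all_predC; apply: eq_all => i /=; rewrite negbK.
by apply: decidable_neg; apply: decidable_has => //; apply: decidable_neg.
Qed.

(* A list is coded by iterated pairing; its length is kept apart. *)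
Definition lookup (d i : nat) : nat := nleft (iter i nright d).

Definition unfold_list (d n : nat) : seq nat := [seq lookup d i | i <- iota 0 n].

Lemma unfold_listP l : exists d, unfold_list d (size l) = l.
Proof.
elim: l => [|w l [d IH]]; first by exists 0.
exists (npair w d); rewrite /unfold_list /= {1}/lookup /= nleftK; congr cons.
rewrite -[RHS]IH -[1]addn0 iotaDl -map_comp; apply: eq_map => i /=.
by rewrite /lookup iterSr nrightK.
Qed.

Lemma computable_lookup d i :
  computable d -> computable i -> computable (fun x => lookup (d x) (i x)).
Proof.
move=> hd hi; apply: computable_nleft.
apply: (@eq_computable (fun x => primrec (d x) (fun _ => nright) (i x))).
  by move=> x; elim: (i x) => //= m ->.
apply: computable_primrec => //.
exact/computable_nright/computable_nright/computable_nright/computable_id.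
Qed.

Lemma decidable_has_list (p : nat -> nat -> bool) d n :
    decidable_pred (fun w => p (nleft w) (nright w)) ->
    computable d -> computable n ->
  decidable_pred (fun x => has (p x) (unfold_list (d x) (n x))).
Proof.
move=> hp hd hn.
apply: (@eq_decidable (fun x => has (fun i => p x (lookup (d x) i)) (iota 0 (n x)))).
  by move=> x; rewrite has_map.
apply: decidable_has => //.
have h : computable (fun w => npair (nleft w) (lookup (d (nleft w)) (nright w))).
  apply: computable_npair; first exact/computable_nleft/computable_id.
  apply: computable_lookup; last exact/computable_nright/computable_id.
  exact/(computable_comp hd)/computable_nleft/computable_id.
apply: eq_decidable (decidable_comp hp h) => w.
by rewrite nleftK nrightK.
Qed.

Ltac computability := repeat (lazymatch goal with
  | |- computable (fun x => x) => exact: computable_id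
  | |- computable nleft => exact: (computable_nleft computable_id)
  | |- computable nright => exact: (computable_nright computable_id)
  | |- computable (fun=> ?k) => exact: computable_const
  | |- computable (fun x => lookup (@?d x) (@?i x)) => apply: computable_lookup
  | |- computable (fun x => npair (@?f x) (@?g x)) => apply: computable_npair
  | |- computable (fun x => nleft (@?f x)) => apply: computable_nleft
  | |- computable (fun x => nright (@?f x)) => apply: computable_nright
  | |- computable (fun x => S (@?f x)) => apply: computable_succ
  | |- computable (fun x => predn (@?f x)) => apply: computable_pred
  | |- computable (fun x => addn (@?f x) (@?g x)) => apply: computable_add
  | |- computable (fun x => subn (@?f x) (@?g x)) => apply: computable_sub
  | |- computable (fun x => muln ?k (@?g x)) => apply: computable_muln
  | |- computable (primrec ?a ?s) =>
      apply: (@computable_primrec (fun=> a) (fun=> s) (fun x => x))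
  | |- computable (fun x => primrec (@?a x) (@?s x) (@?n x)) =>
      apply: computable_primrec
  | |- computable (fun x => nat_of_bool (@?p x)) => change (decidable_pred p)
  | |- decidable_pred (fun=> ?b) => exact: decidable_const
  | |- decidable_pred (fun x => andb (@?p x) (@?q x)) => apply: decidable_and
  | |- decidable_pred (fun x => orb (@?p x) (@?q x)) => apply: decidable_or
  | |- decidable_pred (fun x => negb (@?p x)) => apply: decidable_neg
  | |- decidable_pred (fun x => leq (@?f x) (@?g x)) => apply: decidable_leq
  | |- decidable_pred (fun x => eq_op (@?f x) (@?g x)) => apply: decidable_eq
  | |- decidable_pred (fun x => has (@?p x) (iota 0 (@?n x))) => apply: decidable_has
  | |- decidable_pred (fun x => all (@?p x) (iota 0 (@?n x))) => apply: decidable_all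
  | |- decidable_pred (fun x => has (@?p x) (unfold_list (@?d x) (@?n x))) =>
      apply: decidable_has_list
  | h : computable ?f |- computable ?f => exact: h
  | h : decidable_pred ?p |- decidable_pred ?p => exact: h
  | h : computable ?f |- computable (fun x => ?f (@?g x)) =>
      apply: (computable_comp h)
  | h : decidable_pred ?p |- decidable_pred (fun x => ?p (@?g x)) =>
      apply: (decidable_comp h)
  | |- computable _ => apply: computable_if
  end).

(** * A decidable certificate for computations *)

(* The number [w] stands for the claim that [phi (prog w) (arg w) (res w)]. *)
Definition prog (w : nat) : nat := nleft w.
Definition arg (w : nat) : nat := nleft (nright w).
Definition res (w : nat) : nat := nright (nright w).
Definition claim (e x y : nat) : nat := npair e (npair x y).

Lemma claimK e x y :
  (prog (claim e x y) = e) * (arg (claim e x y) = x) * (res (claim e x y) = y).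
Proof. by rewrite /prog /arg /res !(nleftK, nrightK). Qed.

Definition holds (w : nat) : Prop := phi (prog w) (arg w) (res w).

(** One clause per constructor, with two for [Prec]: counter zero and counter successor. There one
    component of the program occurs in no premise; it is sought below [prog w], which exceeds the
    codes of all components. *)
Definition step_rule (l : seq nat) (w : nat) : bool :=
  [|| (prog w == 0) && (res w == 0),
      (prog w == 1) && (res w == (arg w).+1),
      (prog w == 2) && (res w == nleft (arg w)),
      (prog w == 3) && (res w == nright (arg w)),
      has (fun u => has (fun v =>
        [&& prog w == 4 + 4 * npair (prog u) (prog v), arg u == arg w,
            arg v == arg w & res w == npair (res u) (res v)]) l) l,
      has (fun u => has (fun v =>
        [&& prog w == 5 + 4 * npair (prog v) (prog u), arg u == arg w,
            arg v == res u & res v == res w]) l) l,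
      has (fun u => has (fun g =>
        [&& prog w == 6 + 4 * npair (prog u) g, nright (arg w) == 0,
            arg u == nleft (arg w) & res u == res w]) (iota 0 (prog w))) l,
      has (fun u => has (fun v => has (fun f =>
        [&& prog w == 6 + 4 * npair f (prog v), prog u == prog w,
            nright (arg w) == (nright (arg u)).+1,
            nleft (arg u) == nleft (arg w),
            arg v == npair (nleft (arg w)) (npair (nright (arg u)) (res u)) &
            res v == res w]) (iota 0 (prog w))) l) l |
      has (fun u =>
        [&& prog w == 7 + 4 * prog u, arg u == npair (arg w) (res w), res u == 0 &
            all (fun k => has (fun v =>
              [&& prog v == prog u, arg v == npair (arg w) k & ~~ (res v == 0)]) l)
              (iota 0 (res w))]) l].

Lemma decidable_step_rule d n w :
    computable d -> computable n -> computable w ->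
  decidable_pred (fun x => step_rule (unfold_list (d x) (n x)) (w x)).
Proof.
move=> hd hn hw; rewrite /step_rule /prog /arg /res.
computability.
Qed.

Lemma step_rule_sub l l' w :
  {subset l <= l'} -> step_rule l w -> step_rule l' w.
Proof.
move=> sub.
have has_sub (p q : nat -> bool) : (forall x, p x -> q x) -> has p l -> has q l'.
  by move=> pq /hasP[x /sub ? /pq ?]; apply/hasP; exists x.
have or_sub (a b c d : bool) : (a -> c) -> (b -> d) -> a || b -> c || d.
  by move=> ac bd /orP[/ac->|/bd->]; rewrite ?orbT.
rewrite /step_rule; do 4 apply: (@or_sub) => //.
apply: (@or_sub); first by apply: (@has_sub) => u; apply: (@has_sub).
apply: (@or_sub); first by apply: (@has_sub) => u; apply: (@has_sub).
apply: (@or_sub); first by apply: (@has_sub).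
apply: (@or_sub); first by apply: (@has_sub) => u; apply: (@has_sub).
apply: (@has_sub) => u /and4P[-> -> -> /=].
by apply: sub_all => k; apply: (@has_sub).
Qed.

Lemma step_rule_sound l w :
  (forall u, u \in l -> holds u) -> step_rule l w -> holds w.
Proof.
move=> hl; rewrite /step_rule /holds.
case/or4P => [| | |/or4P[| | |/or3P[]]].
- by move=> /andP[/eqP-> /eqP->]; exists Zero.
- by move=> /andP[/eqP-> /eqP->]; exists Succ.
- by move=> /andP[/eqP-> /eqP->]; exists Left.
- by move=> /andP[/eqP-> /eqP->]; exists Right.
- move=> /hasP[u /hl[f ef hf] /hasP[v /hl[g eg hg]]].
  move=> /and4P[/eqP-> /eqP eu /eqP ev /eqP->].
  exists (Pair f g); first by rewrite /= ef eg.
  by exists (res u), (res v); split; [rewrite -eu|rewrite -ev|].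
- move=> /hasP[u /hl[f ef hf] /hasP[v /hl[g eg hg]]].
  move=> /and4P[/eqP-> /eqP eu /eqP ev /eqP ew].
  exists (Comp g f); first by rewrite /= ef eg.
  by exists (res u); [rewrite -eu|rewrite -ev -ew].
- move=> /hasP[u /hl[f ef hf] /hasP[g _]].
  move=> /and4P[/eqP-> /eqP ew /eqP eu /eqP er].
  have [c hc] := encode_surj g.
  exists (Prec f c); first by rewrite /= ef hc.
  by rewrite /= ew /= -eu -er.
- move=> /hasP[u /hl[c ec hc] /hasP[v /hl[g eg hg] /hasP[f _]]].
  case/and4P=> /eqP ew /eqP eu /eqP ea /and3P[/eqP el /eqP ev /eqP er].
  have [c' hc'] := encode_surj f.
  (* The first premise is about the same program as the conclusion, so injectivity of the encoding
     reveals its [Prec] form. *)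
  have def_c : c = Prec c' g by apply: encode_inj; rewrite ec eu ew /= hc' eg.
  exists c; first by rewrite ec eu.
  move: hc; rewrite def_c /= ea el => hc; exists (res u) => //.
  by rewrite -ev -er.
- move=> /hasP[u /hl[f ef hf]] /and4P[/eqP ew /eqP ea /eqP er /all_iotaP hk].
  exists (Mu f); first by rewrite /= ew ef.
  split; first by rewrite -ea -er.
  move=> k /hk /hasP[v /hl[c ec hc]] /and3P[/eqP ev /eqP ea' r0].
  exists (res v).-1; rewrite prednK ?lt0n // -ea'.
  by have -> : f = c by apply: encode_inj; rewrite ec ev ef.
Qed.

(** * Derivations of claims *)

Definition valid (l : seq nat) : Prop :=
  forall i, i < size l -> step_rule (take i l) (nth 0 l i).

Definition derivable (w : nat) : Prop := exists2 l, valid l & w \in l.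

Lemma valid_cat l l' : valid l -> valid l' -> valid (l ++ l').
Proof.
move=> hl hl' i; rewrite size_cat nth_cat take_cat.
case: (ltnP i (size l)) => [/hl//|le_li lt_i].
apply: (@step_rule_sub (take (i - size l) l')).
  by move=> u; rewrite mem_cat => ->; rewrite orbT.
by apply: hl'; lia.
Qed.

Lemma derivable_seq (s : seq nat) :
  {in s, forall w, derivable w} -> exists2 l, valid l & {subset s <= l}.
Proof.
elim: s => [|w s IH] hs; first by exists [::].
have [|l hl sub_l] := IH; first by move=> u su; apply: hs; rewrite inE su orbT.
have [|l' hl' wl'] := hs w; first by rewrite inE eqxx.
exists (l' ++ l); first exact: valid_cat.
by move=> u; rewrite inE mem_cat => /orP[/eqP->|/sub_l->]; rewrite ?wl' ?orbT.
Qed.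

(** Derivations of the premises are concatenated and the conclusion is appended; extra earlier
    entries do no harm, since the rules are monotone in the list. *)
Lemma derivable_step (s : seq nat) w :
  {in s, forall u, derivable u} -> step_rule s w -> derivable w.
Proof.
move=> /derivable_seq[l hl sub_l] hw; exists (rcons l w); last first.
  by rewrite mem_rcons inE eqxx.
move=> i; rewrite size_rcons ltnS nth_rcons leq_eqVlt => /orP[/eqP->|lt_il].
  by rewrite ltnn eqxx -cats1 take_size_cat //; apply: step_rule_sub hw.
by rewrite lt_il -cats1 takel_cat 1?ltnW //; apply: hl.
Qed.

Lemma eval_derivable c x y : eval c x y -> derivable (claim (encode c) x y).
Proof.
elim: c x y => [||||f IHf g IHg|f IHf g IHg|f IHf g IHg|f IHf] x y /=.
- by move=> ->; apply: (@derivable_step [::]) => //; rewrite /step_rule !claimK.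
- by move=> ->; apply: (@derivable_step [::]) => //; rewrite /step_rule !claimK !eqxx.
- by move=> ->; apply: (@derivable_step [::]) => //; rewrite /step_rule !claimK !eqxx.
- by move=> ->; apply: (@derivable_step [::]) => //; rewrite /step_rule !claimK !eqxx.
- move=> [u [v [/IHf hu /IHg hv ->]]].
  apply: (@derivable_step [:: claim (encode f) x u; claim (encode g) x v]).
    by move=> w; rewrite !inE => /orP[] /eqP->.
  do 4 (apply/orP; right); apply/orP; left.
  by rewrite /= !claimK !eqxx ?orbT.
- move=> [z /IHg hu /IHf hv].
  apply: (@derivable_step [:: claim (encode g) x z; claim (encode f) z y]).
    by move=> w; rewrite !inE => /orP[] /eqP->.
  do 5 (apply/orP; right); apply/orP; left.
  by rewrite /= !claimK !eqxx ?orbT.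
(* The parameter stays fixed and the induction is on the counter: the derivation runs through the
   claims of the same program at all smaller counters. *)
- suff h n : forall z, prec_graph (eval f) (eval g) (nleft x) n z ->
      derivable (claim (6 + 4 * npair (encode f) (encode g)) (npair (nleft x) n) z).
    by move=> /h; rewrite npairK.
  elim: n {y} => [|n IHn] y /=.
    move=> /IHf hu; apply: (@derivable_step [:: claim (encode f) (nleft x) y]).
      by move=> w; rewrite !inE => /eqP->.
    do 6 (apply/orP; right); apply/orP; left.
    rewrite /= orbF; apply/has_iotaP; exists (encode g).
      by rewrite claimK; have := npair_ge (encode f) (encode g); lia.
    by rewrite !claimK nleftK nrightK !eqxx.
  move=> [z /IHn hu /IHg hv]; set e := 6 + _ in hu *.
  apply: (@derivable_step [:: claim e (npair (nleft x) n) z;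
      claim (encode g) (npair (nleft x) (npair n z)) y]).
    by move=> w; rewrite !inE => /orP[] /eqP->.
  do 7 (apply/orP; right); apply/orP; left.
  apply/hasP; exists (claim e (npair (nleft x) n) z); first by rewrite inE eqxx.
  apply/hasP; exists (claim (encode g) (npair (nleft x) (npair n z)) y).
    by rewrite !inE eqxx orbT.
  apply/has_iotaP; exists (encode f).
    by rewrite claimK; have := npair_ge (encode f) (encode g); lia.
  by rewrite !claimK !(nleftK, nrightK) !eqxx.
- move=> [/IHf h0 hS].
  (* [z k] is the predecessor of the nonzero value at [k]; from [y] on it is a dummy 0. *)
  have /choice[z hz] k : exists z, k < y -> eval f (npair x k) z.+1.
    by case: (ltnP k y) => [/hS[z hz]|_]; [exists z | exists 0].
  pose s := [seq claim (encode f) (npair x k) (z k).+1 | k <- iota 0 y].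
  apply: (@derivable_step (claim (encode f) (npair x y) 0 :: s)).
    move=> w; rewrite inE => /orP[/eqP->//|/mapP[k]].
    by rewrite mem_iota => /andP[_ /hz/IHf ?] ->.
  do 8 (apply/orP; right); apply/hasP.
  exists (claim (encode f) (npair x y) 0); first by rewrite inE eqxx.
  rewrite !claimK !eqxx; apply/all_iotaP => k lt_ky; apply/hasP.
  exists (claim (encode f) (npair x k) (z k).+1); last by rewrite !claimK !eqxx.
  by rewrite inE; apply/orP; right; apply/mapP; exists k; rewrite ?mem_iota.
Qed.

(** This plays the part of Kleene's T predicate: [nleft d] is the length of a derivation and
    [nright d] codes its entries. *)
Definition certifies (d w : nat) : bool :=
  all (fun i => step_rule (unfold_list (nright d) i) (lookup (nright d) i))
    (iota 0 (nleft d)) &&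
  has (fun u => u == w) (unfold_list (nright d) (nleft d)).

Lemma phi_certifies e x y : phi e x y <-> exists d, certifies d (claim e x y).
Proof.
split=> [[c <-]|[d /andP[/all_iotaP hd /hasP[u + /eqP def_u]]]].
  move=> /eval_derivable[l hl wl]; have [d hd] := unfold_listP l.
  have take_d i : i < size l -> unfold_list d i = take i l.
    by move=> lt_i; rewrite -[in RHS]hd /unfold_list -map_take take_iota (minn_idPl (ltnW lt_i)).
  exists (npair (size l) d); rewrite /certifies nleftK nrightK hd.
  apply/andP; split; last by apply/hasP; exists (claim (encode c) x y).
  apply/all_iotaP => i lt_i; rewrite take_d //.
  suff -> : lookup d i = nth 0 l i by apply: hl.
  by rewrite -[in RHS]hd (nth_map 0) ?size_iota // nth_iota.
move=> /mapP[i]; rewrite mem_iota => /andP[_ lt_i] def_i.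
suff : holds (lookup (nright d) i).
  by rewrite -def_i def_u /holds !claimK.
(* Strong induction on the position in the derivation, as each entry rests on earlier ones only. *)
have [k] := ubnP i; elim: k i lt_i {def_i} => // k IH i lt_i lt_ik.
apply: step_rule_sound (hd i lt_i) => v /mapP[j].
by rewrite mem_iota => /andP[_ lt_ji] ->; apply: IH; lia.
Qed.

Lemma decidable_certifies d w :
  computable d -> computable w -> decidable_pred (fun x => certifies (d x) (w x)).
Proof.
move=> hd hw; apply: decidable_and; last by computability.
apply: (@decidable_all (fun x i =>
  step_rule (unfold_list (nright (d x)) i) (lookup (nright (d x)) i))).
  by apply: decidable_step_rule; computability.
by computability.
Qed.

(** * Semidecidable predicates, the s-m-n theorem, the recursion theorem *)

Definition semidecidable (V : nat -> Prop) : Prop :=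
  exists2 p, decidable_pred p & forall x, V x <-> exists d, p (npair x d).

Lemma eq_semidecidable U V :
  (forall x, U x <-> V x) -> semidecidable U -> semidecidable V.
Proof. by move=> UV [p hp hU]; exists p => // x; rewrite -UV. Qed.

Lemma semidecidable_pred p : decidable_pred p -> semidecidable p.
Proof.
move=> hp; exists (fun w => p (nleft w)); first by computability.
by move=> x; split=> [px|[d]]; [exists 0|]; rewrite nleftK.
Qed.

Lemma semidecidable_eq f g :
  computable f -> computable g -> semidecidable (fun x => f x = g x).
Proof.
move=> hf hg; apply: eq_semidecidable (semidecidable_pred (decidable_eq hf hg)).
by move=> x; split=> /eqP.
Qed.

Lemma semidecidable_comp V f :
  semidecidable V -> computable f -> semidecidable (fun x => V (f x)).
Proof.
move=> [p hp hV] hf; exists (fun w => p (npair (f (nleft w)) (nright w))).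
  by computability.
by move=> x; rewrite hV; split=> -[d hd]; exists d; rewrite ?nleftK ?nrightK // in hd *.
Qed.

Lemma semidecidable_ex (V : nat -> nat -> Prop) :
  semidecidable (fun w => V (nleft w) (nright w)) ->
  semidecidable (fun x => exists y, V x y).
Proof.
move=> [p hp hV].
exists (fun w => p (npair (npair (nleft w) (nleft (nright w))) (nright (nright w)))).
  by computability.
move=> x; split=> [[y]|[d]].
  have := hV (npair x y); rewrite nleftK nrightK => -> [d hd].
  by exists (npair y d); rewrite !(nleftK, nrightK).
rewrite nleftK nrightK => hd; exists (nleft d).
by have := hV (npair x (nleft d)); rewrite nleftK nrightK => ->; exists (nright d).
Qed.

Lemma semidecidable_and U V :
  semidecidable U -> semidecidable V -> semidecidable (fun x => U x /\ V x).
Proof.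
move=> [p hp hU] [q hq hV].
exists (fun w => p (npair (nleft w) (nleft (nright w))) &&
                 q (npair (nleft w) (nright (nright w)))); first by computability.
move=> x; rewrite hU hV; split=> [[[c hc] [d hd]]|[d]].
  by exists (npair c d); rewrite !(nleftK, nrightK) hc.
by rewrite !(nleftK, nrightK) => /andP[]; split; [exists (nleft d)|exists (nright d)].
Qed.

Lemma semidecidable_or U V :
  semidecidable U -> semidecidable V -> semidecidable (fun x => U x \/ V x).
Proof.
move=> [p hp hU] [q hq hV]; exists (fun w => p w || q w); first by computability.
move=> x; rewrite hU hV; split=> [[[d hd]|[d hd]]|[d /orP[hd|hd]]].
- by exists d; rewrite hd.
- by exists d; rewrite hd orbT.
- by left; exists d.
- by right; exists d.
Qed.

Lemma semidecidable_phi e x y : computable e -> computable x -> computable y ->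
  semidecidable (fun w => phi (e w) (x w) (y w)).
Proof.
move=> he hx hy.
apply: (@eq_semidecidable (fun w => exists d, certifies d (claim (e w) (x w) (y w)))).
  by move=> w; rewrite phi_certifies.
apply: semidecidable_ex; apply: semidecidable_pred; rewrite /claim.
by apply: decidable_certifies; computability.
Qed.

Ltac semidecidability := repeat (lazymatch goal with
  | |- semidecidable (fun x => phi (@?e x) (@?u x) (@?v x)) =>
      apply: semidecidable_phi
  | |- semidecidable (fun x => @?f x = @?g x) => apply: semidecidable_eq
  | |- semidecidable (fun x => @?f x /\ @?g x) => apply: semidecidable_and
  | |- semidecidable (fun x => @?f x \/ @?g x) => apply: semidecidable_or
  | |- semidecidable (fun x => exists y, @?f x y) => apply: semidecidable_ex
  | |- semidecidable (fun x => is_true (@?p x)) => apply: semidecidable_pred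
  | h : semidecidable ?V |- semidecidable ?V => exact: h
  | h : semidecidable ?V |- semidecidable (fun x => ?V (@?g x)) =>
      apply: (semidecidable_comp h)
  | _ => progress computability
  end).

(** The program has [p] hard-wired, searches for a witness of [V p n] and then returns its own
    input. Its domain and its range are thus both [V p]. *)
Lemma smn (V : nat -> nat -> Prop) :
    semidecidable (fun w => V (nleft w) (nright w)) ->
  exists2 g, computable g & forall p n y, phi (g p) n y <-> V p n /\ y = n.
Proof.
move=> [p hp hV].
(* [Mu] looks for a zero, hence the negation. *)
have /computableP[f hf] : computable (fun w => ~~ p w : nat).
  exact: decidable_neg.
have hMu w : V (nleft w) (nright w) <-> exists d, eval (Mu f) w d.
  rewrite hV; split=> [ex_d|[d [f0 _]]]; last first.
    by exists d; move: (eval_fun f0 (hf _)); case: (p _).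
  exists (ex_minn ex_d); case: ex_minnP => d pd min_d; split.
    by have := hf (npair w d); rewrite pd.
  move=> k lt_kd; exists 0; have := hf (npair w k).
  by case: (p _) (min_d k) => // /(_ isT); rewrite leqNgt lt_kd.
(* On a pair, [c] runs the search on the whole pair, discards the witness found and returns the
   right component. *)
pose c := Comp Left (Pair Right (Mu f)).
pose cst := fix cst n := if n is m.+1 then Comp Succ (cst m) else Zero.
have cstE n x : eval (cst n) x n by elim: n => //= n IH; exists n.
exists (fun n => encode (Comp c (Pair (cst n) (Pair Left Right)))).
  (* The code of [cst n] is primitive recursive in [n]: 1 is the code of [Succ], and [5 + 4 * npair]
     builds that of a composition. *)
  apply: (@eq_computable (fun n => 5 + 4 * npair (encode c)
      (4 + 4 * npair (primrec 0 (fun _ r => 5 + 4 * npair 1 r) n)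
                     (encode (Pair Left Right))))).
    by move=> n; congr (5 + 4 * npair _ (4 + 4 * npair _ _)); elim: n => //= n ->.
  by computability.
move=> n x y; have := hMu (npair n x); rewrite nleftK nrightK => ->.
have hPair : eval (Pair (cst n) (Pair Left Right)) x (npair n x).
  by exists n, x; split=> //; exists (nleft x), (nright x); rewrite npairK.
split=> [[c' /encode_inj-> [z /(eval_fun hPair)<-]]|[[d hd] ->]].
  by move=> [_ [_ [d [-> hd ->]]] ->]; rewrite nrightK nleftK; split=> //; exists d.
exists (Comp c (Pair (cst n) (Pair Left Right))) => //; exists (npair n x) => //.
exists (npair x d); last by rewrite /= nleftK.
by exists x, d; split=> //; rewrite /= nrightK.
Qed.

Lemma ce_semidecidable X : ce X <-> semidecidable X.
Proof.
split=> [[e ->]|hX]; first by rewrite /W /mkset; semidecidability.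
have [|g _ hg] := @smn (fun _ => X); first by semidecidability.
exists (g 0); apply/seteqP; split=> [n Xn|n [y /hg[]//]].
by exists n; apply/hg.
Qed.

Definition range_phi (e : nat) : set nat := [set y | exists n, phi e n y].

Lemma smn_range (V : nat -> nat -> Prop) :
    semidecidable (fun w => V (nleft w) (nright w)) ->
  exists2 g, computable g & forall p, range_phi (g p) = V p /\ W (g p) = V p.
Proof.
move=> /smn[g hg gV]; exists g => // p; split; apply/seteqP; split=> y.
- by move=> [n /gV[Vn ->]].
- by move=> Vy; exists y; apply/gV.
- by move=> [n /gV[]].
- by move=> Vy; exists y; apply/gV.
Qed.

(** Let [g p] enumerate [V q] for [q] the value of program [p] on its own number, if there is one.
    With [h] an index of [g] itself, that value is [g h], which is the fixed point. *)
Lemma recursion_theorem (V : nat -> nat -> Prop) :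
    semidecidable (fun w => V (nleft w) (nright w)) ->
  exists e, range_phi e = V e.
Proof.
move=> hV; have [|g hg gV] :=
  @smn_range (fun p y => exists q, phi p p q /\ V q y).
  have hV' f h : computable f -> computable h -> semidecidable (fun w => V (f w) (h w)).
    move=> hf hh; apply: eq_semidecidable (semidecidable_comp hV (computable_npair hf hh)).
    by move=> w; rewrite nleftK nrightK.
  by apply: semidecidable_ex; apply: semidecidable_and; [|apply: hV']; semidecidability.
have [h hh] := hg; exists (g h); have [-> _] := gV h; apply/seteqP; split=> y.
  by move=> [q [/(phi_fun (hh h)) <-]].
by move=> Vy; exists (g h).
Qed.

(** * Maximal sets and descending sequences *)

(* [l (npair s (npair z n))] reads: "[z] leads level [n] at stage [s]".  The [k]-th block
   consists of the levels [n] with [block u k < n <= block u k.+1]; with [u := last_injury l ^~ s]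
   it is the stage [s] guess, revised whenever a number starts to lead, for the first time
   at any level, at or below the lower end of the block. *)
Definition led (l : nat -> bool) (s z : nat) : bool :=
  has (fun n => l (npair s (npair z n))) (iota 0 s.+1).

Definition first_led (l : nat -> bool) (s z : nat) : bool :=
  led l s z && ~~ has (fun t => led l t z) (iota 0 s).

Definition injury (l : nat -> bool) (b s : nat) : bool :=
  has (fun z => first_led l s z && has (fun n => l (npair s (npair z n))) (iota 0 b.+1))
    (iota 0 s.+1).

(** The value 0 stands both for no injury and for an injury at stage 0, so stage 0 is never
    tested. *)
Definition last_injury (l : nat -> bool) (b s : nat) : nat :=
  primrec 0 (fun m r => if injury l b m.+1 then m.+1 else r) s.

Definition block (u : nat -> nat) (k : nat) : nat :=
  primrec 0 (fun _ b => b + u b + 2) k.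

Lemma first_led_uniq l s t z : first_led l s z -> first_led l t z -> s = t.
Proof.
move=> /andP[ls /has_iotaP Ns] /andP[lt /has_iotaP Nt].
by case: (ltngtP s t) => // lt_st; [case: Nt; exists s|case: Ns; exists t].
Qed.

Lemma last_injuryS l b s :
  last_injury l b s.+1 = if injury l b s.+1 then s.+1 else last_injury l b s.
Proof. by []. Qed.

Lemma last_injury_le l b s : last_injury l b s <= s.
Proof. by elim: s => // s; rewrite last_injuryS; case: ifP => //; lia. Qed.

Lemma last_injury_ge l b t s : injury l b t -> t <= s -> t <= last_injury l b s.
Proof.
move=> inj_t; elim: s => [|s IH]; first by rewrite leqn0 => /eqP->.
rewrite leq_eqVlt ltnS last_injuryS => /orP[/eqP<-|le_ts]; first by rewrite inj_t.
by case: ifP => _; [lia|apply: IH].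
Qed.

Lemma last_injury_stable l b v s :
  (forall t, injury l b t -> t <= v) -> v <= s -> last_injury l b s = last_injury l b v.
Proof.
move=> hv; elim: s => [|s IH]; first by rewrite leqn0 => /eqP->.
rewrite leq_eqVlt ltnS => /orP[/eqP<-//|le_vs]; rewrite last_injuryS -IH //.
by case: ifP => // /hv; lia.
Qed.

Lemma injury_mono l b c s : b <= c -> injury l b s -> injury l c s.
Proof.
move=> le_bc /has_iotaP[z lt_z /andP[fz /has_iotaP[n lt_n ln]]].
apply/has_iotaP; exists z; rewrite // fz; apply/has_iotaP; exists n => //.
by lia.
Qed.

Lemma last_injury_mono l b c s : b <= c -> last_injury l b s <= last_injury l c s.
Proof.
move=> le_bc; elim: s => // s IH; rewrite !last_injuryS.
case: ifP => [/(injury_mono le_bc)->//|_]; case: ifP => // _.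
by have := last_injury_le l b s; lia.
Qed.

Lemma bound_below (P : nat -> nat -> Prop) m :
    (forall i, exists u, forall t, P i t -> t <= u) ->
  exists u, forall i t, i < m -> P i t -> t <= u.
Proof.
move=> h; elim: m => [|m [u hu]]; first by exists 0.
have [v hv] := h m; exists (maxn u v) => i t.
rewrite ltnS leq_eqVlt leq_max => /orP[/eqP-> /hv->|lt_i /(hu _ _ lt_i)->//].
by rewrite orbT.
Qed.

(** Only finitely many numbers ever lead a level up to [b], and each can injure only at the single
    stage where it first leads; so the injuries stop and the guesses converge. *)
Lemma last_injury_lim (l : nat -> bool) :
    (forall n, exists m, forall z, (exists s, l (npair s (npair z n))) -> z <= m) ->
  exists u : nat -> nat, [/\ forall b t, injury l b t -> t <= u b,
    forall b s, u b <= s -> last_injury l b s = u b & {homo u : b c / b <= c}].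
Proof.
move=> l_fin.
have /choice[v hv] b : exists v, forall t, injury l b t -> t <= v.
  have [m hm] := bound_below b.+1 l_fin.
  have [z|v hv] := @bound_below (fun z t => first_led l t z) m.+1.
    have [[s hs]|no_s] := pselect (exists s, first_led l s z).
      by exists s => t ht; rewrite (first_led_uniq ht hs).
    by exists 0 => t ht; case: no_s; exists t.
  exists v => t /has_iotaP[z _ /andP[fz /has_iotaP[n lt_n ln]]].
  by apply: (hv z) => //; rewrite ltnS; apply: (hm n) => //; exists t.
(* The chosen bound [v b] is arbitrary; the last injury before it is the true limit, and only that
   is monotone in [b]. *)
pose u b := last_injury l b (v b).
have uP b t : injury l b t -> t <= u b.
  by move=> ht; apply: last_injury_ge (hv b t ht).
have u_lim b s : u b <= s -> last_injury l b s = u b.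
  move=> le_us; rewrite (last_injury_stable (uP b)) //.
  by rewrite -(last_injury_stable (uP b) (last_injury_le _ _ _)).
exists u; split=> // b c le_bc; pose s := maxn (u b) (u c).
rewrite -(u_lim b s) ?leq_maxl // -(u_lim c s) ?leq_maxr //.
exact: last_injury_mono.
Qed.

Lemma blockS u k : block u k.+1 = block u k + u (block u k) + 2.
Proof. by []. Qed.

Lemma block_mono u : {mono block u : i j / i <= j}.
Proof.
apply: leq_mono; apply: homo_ltn => [|i]; first exact: ltn_trans.
by rewrite blockS; lia.
Qed.

(** The boundaries up to index [k.+1] depend on the guesses at boundaries up to [block u k] only. By
    monotonicity of [u], all of these have settled by stage [u (block u k)]. *)
Lemma block_lim l u k s :
    (forall b s, u b <= s -> last_injury l b s = u b) ->
    {homo u : b c / b <= c} -> u (block u k) <= s ->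
  forall i, i <= k.+1 -> block (last_injury l ^~ s) i = block u i.
Proof.
move=> u_lim u_homo le_s; elim=> // i IH lt_ik; rewrite !blockS.
rewrite IH ?(ltnW lt_ik) // u_lim //; apply: leq_trans le_s; apply: u_homo.
by rewrite block_mono.
Qed.

(* There are [u (block u k)] + 2 levels in the [k]-th block and the [r] are distinct,
   so that one of the [r n] with [n] in that block exceeds [u (block u k)]. *)
Lemma first_led_in_block (l : nat -> bool) u r k :
    (forall s z n, l (npair s (npair z n)) -> z <= s /\ n <= s) ->
    (forall n, exists s, l (npair s (npair (r n) n))) ->
    (forall s m n, l (npair s (npair (r m) n)) -> n <= m) ->
    (forall b t, injury l b t -> t <= u b) ->
  exists m s, [/\ block u k < m <= block u k.+1, u (block u k) < s,
    first_led l s (r m) & forall n, l (npair s (npair (r m) n)) ->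
      block u k < n <= block u k.+1].
Proof.
move=> l_le r_led r_max uP; set b := block u k; rewrite blockS -/b.
have r_inj : injective r.
  move=> m n eq_r; apply/eqP; rewrite eqn_leq.
  have [[s hs] [t ht]] := (r_led m, r_led n).
  by rewrite (r_max s n m) ?(r_max t m n) ?eq_r // -eq_r.
have [m lt_m lt_r] : exists2 m, b < m <= b + u b + 2 & u b < r m.
  apply: contrapT => no_m.
  have r_le i : i < u b + 2 -> r (b.+1 + i) < (u b).+1.
    move=> lt_i; rewrite ltnS leqNgt; apply/negP => lt_u.
    by apply: no_m; exists (b.+1 + i) => //; lia.
  pose h (i : 'I_(u b + 2)) := Ordinal (r_le i (ltn_ord i)).
  have /leq_card : injective h.
    by move=> i j /(congr1 val)/r_inj/addnI/val_inj.
  by rewrite !card_ord; lia.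
have ex_s : exists s, led l s (r m).
  have [s hs] := r_led m; exists s; apply/has_iotaP; exists m => //.
  by rewrite ltnS; have [] := l_le _ _ _ hs.
case: (ex_minnP ex_s) => s led_s min_s.
have first_s : first_led l s (r m).
  by rewrite /first_led led_s; apply/has_iotaP => -[t lt_ts /min_s]; lia.
have le_rs : r m <= s by have /has_iotaP[n _ /l_le[]] := led_s.
exists m, s; split=> //; first exact: leq_trans le_rs.
move=> n ln; have le_nm := r_max _ _ _ ln.
apply/andP; split; last by lia.
(* Leading at or below [b] would make [s] an injury, but [s] comes after the last one:
   [u b < r m <= s]. *)
rewrite ltnNge; apply/negP => le_nb; suff /uP : injury l b s by lia.
apply/has_iotaP; exists (r m) => //; rewrite first_s.
by apply/has_iotaP; exists n.
Qed.

(* [X] collects the numbers that first lead in an even block.  The number found by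
   [first_led_in_block] first leads after the block has settled, so the guess is correct
   and the parity of the block decides whether it is in [X]. *)
Lemma leaders_split (l : nat -> bool) r :
    decidable_pred l ->
    (forall s z n, l (npair s (npair z n)) -> z <= s /\ n <= s) ->
    (forall n, exists m, forall z, (exists s, l (npair s (npair z n))) -> z <= m) ->
    (forall n, exists s, l (npair s (npair (r n) n))) ->
    (forall s m n, l (npair s (npair (r m) n)) -> n <= m) ->
  exists2 X, ce X & exists f : nat -> nat,
    [/\ injective f, forall k, X (r (f k.*2)) & forall k, ~ X (r (f k.*2.+1))].
Proof.
move=> l_dec l_le l_fin r_led r_max.
have [u [uP u_lim u_homo]] := last_injury_lim l_fin.
pose X z := exists s k n, [/\ first_led l s z, l (npair s (npair z n)) &
  block (last_injury l ^~ s) k.*2 < n <= block (last_injury l ^~ s) k.*2.+1].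
exists X.
  apply/ce_semidecidable.
  apply: (@eq_semidecidable (fun z => exists s k n, [&& first_led l s z, l (npair s (npair z n)),
     block (last_injury l ^~ s) (2 * k) < n & n <= block (last_injury l ^~ s) (2 * k).+1])).
    move=> z; split=> -[s [k [n hn]]]; exists s, k, n; move: hn; rewrite mul2n.
      by move=> /and4P[-> -> -> ->].
    by move=> [-> -> /andP[-> ->]].
  rewrite /block /last_injury /injury /first_led /led.
  by semidecidability.
have /choice[f hf] k := first_led_in_block k l_le r_led r_max uP.
have f_blk k : block u k < f k <= block u k.+1 by have [s []] := hf k.
exists f; split=> [i j eq_f|k|k].
(* The blocks are disjoint, so [f k] determines [k]. *)
- apply/eqP; rewrite eqn_leq; apply/andP; split; rewrite -ltnS -(leqW_mono (block_mono u)).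
    by have := f_blk i; have := f_blk j; rewrite eq_f; lia.
  by have := f_blk i; have := f_blk j; rewrite eq_f; lia.
- have [s [_ lt_us fs ls]] := hf k.*2; exists s, k.
  have /andP[/has_iotaP[n _ ln] _] := fs; exists n; split=> //.
  by rewrite !(block_lim u_lim u_homo (ltnW lt_us)) //; apply: ls.
- have [s [_ lt_us fs ls]] := hf k.*2.+1.
  move=> [t [j [n [ft lt]]]]; rewrite -(first_led_uniq fs ft) in lt *.
  have := ls _ lt; have lim := block_lim u_lim u_homo (ltnW lt_us).
  (* Block [j.*2] lies entirely below or entirely above block [k.*2.+1]. In the case above, the
     guess for its lower end may not have settled; monotonicity of the guessed boundaries, from the
     settled index [k.*2.+2] on, suffices. *)
  set c := last_injury l ^~ s; have [le_jk|lt_kj] := leqP j k.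
    rewrite (lim j.*2.+1) ?ltnS ?leqW ?leq_double //.
    have : block u j.*2.+1 <= block u k.*2.+1 by rewrite block_mono ltnS leq_double.
    by lia.
  rewrite -(lim k.*2.+2) // -/c.
  have : block c k.*2.+2 <= block c j.*2 by rewrite block_mono -doubleS leq_double.
  by lia.
Qed.

(** * Maximality against uniformly c.e. descending families *)

Lemma infinite_of_injection (X : set nat) (f : nat -> nat) :
  injective f -> (forall k, X (f k)) -> infinite_set X.
Proof.
move=> f_inj Xf fin_X; have : finite_set (range f).
  by apply: sub_finite_set fin_X => _ [k _ <-].
suff /eq_finite_set -> : (range f #= [set: nat])%card by exact: infinite_nat.
by apply: inj_card_eq => i j _ _ /f_inj.
Qed.

(* Replace [T n] by its union with [A].  The leader of level [n] at stage [s] is the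
   least number seen to be in [T n] but not in [T n.+1]; it converges to the least
   element [r n] of the difference, and [r n] never leads a level above [n]. *)
Lemma maximal_no_descending_family (A : set nat) (T : nat -> nat -> Prop) :
    maximal A -> semidecidable (fun w => T (nleft w) (nright w)) ->
    (forall n z, T n.+1 z -> T n z) ->
  exists n, forall z, T n z -> ~ T n.+1 z -> A z.
Proof.
move=> [/ce_semidecidable sdA _ maxA] sdT desc; apply: contrapT => strict.
pose U n z := T n z \/ A z.
have [p dec_p hp] : semidecidable (fun w => U (nleft w) (nright w)).
  by rewrite /U; semidecidability.
have UP n z : U n z <-> exists d, p (npair (npair n z) d).
  by have := hp (npair n z); rewrite nleftK nrightK.
pose t n z s := has (fun d => p (npair (npair n z) d)) (iota 0 s).
have t_sound n z s : t n z s -> U n z.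
  by move=> /has_iotaP[d _ pd]; apply/UP; exists d.
have t_complete n z : U n z -> exists s0, forall s, s0 <= s -> t n z s.
  by move=> /UP[d pd]; exists d.+1 => s lt_ds; apply/has_iotaP; exists d.
have U_desc m n z : m <= n -> U n z -> U m z.
  elim: n => [|n IH]; first by rewrite leqn0 => /eqP->.
  rewrite leq_eqVlt ltnS => /orP[/eqP->//|/IH Unm] [/desc Tz|Az]; apply: Unm.
    by left.
  by right.
pose at_level n z s := t n z s && ~~ t n.+1 z s.
pose l w := let s := nleft w in let z := nleft (nright w) in let n := nright (nright w) in
  [&& z <= s, n <= s, at_level n z s & ~~ has (fun y => at_level n y s) (iota 0 z)].
have lE s z n : l (npair s (npair z n)) =
    [&& z <= s, n <= s, at_level n z s & ~~ has (fun y => at_level n y s) (iota 0 z)].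
  by rewrite /l !(nleftK, nrightK).
have l_dec : decidable_pred l.
  by rewrite /l /at_level /t; computability.
have exr n : exists z, `[< U n z /\ ~ U n.+1 z >].
  apply: contrapT => no_z; apply: strict; exists n => z Tz nTz.
  apply: contrapT => nAz; apply: no_z; exists z; apply/asboolP; split; first by left.
  by case.
pose r n := ex_minn (exr n).
have rP n : [/\ U n (r n), ~ U n.+1 (r n) & forall y, y < r n -> U n y -> U n.+1 y].
  rewrite /r; case: ex_minnP => z /asboolP[Uz nUz] min_z; split=> // y lt_yz Uy.
  apply: contrapT => nUy; have := min_z y; rewrite leqNgt lt_yz.
  by move=> /(_ (asboolT (conj Uy nUy))).
have r_lim n : exists s0, forall s, s0 <= s ->
    at_level n (r n) s /\ forall y, y < r n -> ~~ at_level n y s.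
  have [Ur nUr min_r] := rP n; have [s0 hs0] := t_complete _ _ Ur.
  (* Each [y] below [r n] is at the level for boundedly many stages: either it is eventually seen in
     [U n.+1], or by minimality of [r n] it is not even in [U n]. *)
  have [y|s1 hs1] := @bound_below (fun y s => y < r n /\ at_level n y s) (r n).
    have [/t_complete[s1 hs1]|nUy] := pselect (U n.+1 y).
      exists s1 => s [_ /andP[_ nt]]; rewrite leqNgt; apply: contra nt => lt_s.
      exact/hs1/ltnW.
    by exists 0 => s [/min_r Uy /andP[/t_sound/Uy]].
  exists (maxn s0 s1.+1) => s; rewrite geq_max => /andP[le_s0 lt_s1]; split.
    by rewrite /at_level hs0 //; apply/negP => /t_sound/nUr.
  by move=> y lt_y; apply/negP => y_at; have := hs1 y s lt_y (conj lt_y y_at); lia.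
have [||||X ceX [f [f_inj Xr nXr]]] := @leaders_split l r l_dec.
- by move=> s z n; rewrite lE => /and4P[].
(* A leader is at most its stage, so before [s0] leaders are bounded by [s0]; from then on [r n] is
   at the level and bounds them. *)
- move=> n; have [s0 hs0] := r_lim n; exists (maxn s0 (r n)) => z [s].
  rewrite lE leq_max => /and4P[le_zs _ _ /has_iotaP no_y].
  have [le_s0|lt_s0] := leqP s0 s; last by apply/orP; left; lia.
  apply/orP; right; rewrite leqNgt; apply/negP => lt_rz; apply: no_y.
  by exists (r n) => //; have [] := hs0 s le_s0.
- move=> n; have [s0 hs0] := r_lim n.
  pose s := maxn s0 (maxn n (r n)); have [at_r no_y] := hs0 s (leq_maxl _ _).
  exists s; rewrite lE at_r !leq_max !leqnn !orbT /=.
  by apply/has_iotaP => -[y /no_y/negP].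
- move=> s m n; rewrite lE => /and4P[_ _ /andP[/t_sound Unr _] _].
  rewrite leqNgt; apply/negP => lt_mn; have [_ + _] := rP m; apply.
  exact: U_desc Unr.
have r_inj : injective r.
  move=> m n eq_r; have [[Um nUm _] [Un nUn _]] := (rP m, rP n).
  case: (ltngtP m n) => // lt_mn.
    by case: nUm; rewrite eq_r; apply: U_desc Un.
  by case: nUn; rewrite -eq_r; apply: U_desc Um.
have nAr n : ~ A (r n) by have [_ nU _] := rP n => Ar; apply: nU; right.
have inj_even : injective (fun k => r (f k.*2)).
  by move=> i j /r_inj/f_inj/double_inj.
have inj_odd : injective (fun k => r (f k.*2.+1)).
  by move=> i j /r_inj/f_inj[]/double_inj.
have [fin|fin] := maxA X ceX.
  by apply: (infinite_of_injection inj_even _ fin) => k; split; [exact: Xr|exact: nAr].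
by apply: (infinite_of_injection inj_odd _ fin) => k; split; [exact: nXr|exact: nAr].
Qed.

(** * Jumps *)

Definition saturate (A X : set nat) : set nat :=
  [set z | exists y, X y /\ eqrel_of A y z].

Lemma eqrel_of_sym A y z : eqrel_of A y z -> eqrel_of A z y.
Proof. by case=> [->|[]]; [left|right]. Qed.

Lemma eqrel_of_trans A x y z : eqrel_of A x y -> eqrel_of A y z -> eqrel_of A x z.
Proof. by case=> [->//|[Ax Ay]] [<-|[_ Az]]; right. Qed.

Lemma eqclass_eq A x y : eqrel_of A x y -> eqclass (eqrel_of A) x = eqclass (eqrel_of A) y.
Proof.
move=> xy; apply/seteqP; split=> z /=; apply: eqrel_of_trans => //.
exact: eqrel_of_sym.
Qed.

Lemma saturate_closed A X y z : saturate A X y -> eqrel_of A y z -> saturate A X z.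
Proof. by move=> [x [Xx xy]] yz; exists x; split=> //; apply: eqrel_of_trans yz. Qed.

Lemma saturate_id A X : (forall y z, X y -> eqrel_of A y z -> X z) -> saturate A X = X.
Proof.
move=> Xcl; apply/seteqP; split=> z; first by move=> [y [Xy /(Xcl _ _ Xy)]].
by move=> Xz; exists z; split=> //; left.
Qed.

Lemma saturateU A X Y : saturate A (X `|` Y) = saturate A X `|` saturate A Y.
Proof.
apply/seteqP; split=> z.
  by move=> [y [[Xy|Yy] yz]]; [left|right]; exists y.
by move=> [] [y [y_in yz]]; exists y; split=> //; [left|right].
Qed.

Definition jump_set (A : set nat) (e : nat) : set nat := saturate A (range_phi e).

(** Classes are disjoint or equal, so a set of classes and its union determine each other, already
    at the level of inclusions. *)
Lemma fs_jumpP A e e' : fs_jump (eqrel_of A) e e' <-> jump_set A e = jump_set A e'.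
Proof.
have sub c d : class_set (eqrel_of A) c `<=` class_set (eqrel_of A) d <->
    jump_set A c `<=` jump_set A d.
  split=> [cd z [y [[n cy] yz]]|cd _ [n [y [cy ->]]]].
    have [|m [x [dx eq_yx]]] := cd (eqclass (eqrel_of A) y); first by exists n, y.
    exists x; split; first by exists m.
    by move: yz; rewrite -[_ y z]/(eqclass _ y z) eq_yx.
  have [|x [[m dx] xy]] := cd y.
    by exists y; split; [exists n|left].
  by exists m, x; split=> //; apply/eqclass_eq/eqrel_of_sym.
split=> [/seteqP[cd dc]|/seteqP[cd dc]]; apply/seteqP; split; exact/sub.
Qed.

Lemma semidecidable_jump_set A e z : ce A -> computable e -> computable z ->
  semidecidable (fun w => jump_set A (e w) (z w)).
Proof.
move=> /ce_semidecidable hA he hz.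
by rewrite /jump_set /saturate /range_phi /eqrel_of /mkset; semidecidability.
Qed.

(** * Reductions between jumps *)

Lemma reducible_trans E F G : reducible E F -> reducible F G -> reducible E G.
Proof.
move=> [f [hf fP]] [g [hg gP]]; exists (fun x => g (f x)); split.
  exact: computable_comp.
by move=> x y; rewrite fP gP.
Qed.

Lemma computable_jump_set A : ce A ->
  exists2 g, computable g & forall e, range_phi (g e) = jump_set A e /\ W (g e) = jump_set A e.
Proof. by move=> ceA; apply: smn_range; apply: semidecidable_jump_set; computability. Qed.

Lemma jump_reducible_sub A B : ce A -> B `<=` A ->
  reducible (fs_jump (eqrel_of A)) (fs_jump (eqrel_of B)).
Proof.
move=> ceA BA; have [g hg gP] := computable_jump_set ceA.
exists g; split=> // x y; rewrite !fs_jumpP.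
suff gB e : jump_set B (g e) = jump_set A e by rewrite !gB.
rewrite /jump_set (gP e).1; apply: saturate_id => u v su uv.
by apply: saturate_closed su _; case: uv => [->|[/BA ? /BA ?]]; [left|right].
Qed.

Lemma jump_reducible_eqce A : ce A -> reducible (fs_jump (eqrel_of A)) eqce.
Proof.
move=> /computable_jump_set[g hg gP]; exists g; split=> // x y.
by rewrite fs_jumpP /eqce (gP x).2 (gP y).2.
Qed.

(* The witness [e] enumerates the range of [x], and that of [y] too once [z] appears in
   the set coded by [f e]. *)
Lemma jump_reduction_monotone A B f x y : ce A -> computable f ->
    (forall x y, fs_jump (eqrel_of B) x y <-> fs_jump (eqrel_of A) (f x) (f y)) ->
  jump_set B x `<=` jump_set B y -> jump_set A (f x) `<=` jump_set A (f y).
Proof.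
move=> ceA hf fP xy z zx; apply: contrapT => nzy.
have [|e he] := @recursion_theorem (fun e u =>
    (exists n, phi x n u) \/ ((exists n, phi y n u) /\ jump_set A (f e) z)).
  have hz : semidecidable (fun w => jump_set A (f (nleft w)) z).
    by apply: semidecidable_jump_set; computability.
  by semidecidability.
(* If [z] appears, [e] enumerates both ranges and is equivalent to [y], so [z] is in the set of
   [f y]. If not, [e] is equivalent to [x], whose image does contain [z]. *)
have [ze|nze] := pselect (jump_set A (f e) z).
  apply: nzy; suff /fP/fs_jumpP <- : fs_jump (eqrel_of B) e y by [].
  apply/fs_jumpP; rewrite /jump_set.
  have -> : range_phi e = range_phi x `|` range_phi y.
    rewrite he; apply/seteqP; split=> u; first by move=> [|[]]; [left|right].
    by move=> [|]; [left|right].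
  by rewrite saturateU; apply/setUidPr.
suff /fP/fs_jumpP eq_ex : fs_jump (eqrel_of B) e x.
  by apply: nze; rewrite eq_ex.
apply/fs_jumpP; rewrite /jump_set; congr saturate; rewrite he.
by apply/seteqP; split=> u; [move=> [//|[_ /nze]]|left].
Qed.

(** The final segments above [a + n] descend by one point at a time, so one of the points removed,
    all larger than [a], must lie in [A]. *)
Lemma maximal_neq_set1 A a : maximal A -> exists2 b, A b & b <> a.
Proof.
move=> maxA; have [||n hn] := @maximal_no_descending_family A (fun n z => a + n < z) maxA.
- by semidecidability.
- by move=> n z; lia.
- by exists (a + n).+1; [apply: hn|]; lia.
Qed.

Lemma jump_not_reducible A B : maximal A -> B `<` A ->
  ~ reducible (fs_jump (eqrel_of B)) (fs_jump (eqrel_of A)).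
Proof.
move=> maxA [BA /existsNP[a /not_implyP[Aa nBa]]] [f [hf fP]].
have [ceA _ _] := maxA.
have [b Ab neq_ba] := maximal_neq_set1 a maxA.
have mono := jump_reduction_monotone ceA hf fP.
have [|g hg gP] := @smn_range (fun e z => jump_set A e z /\ z != a).
  by apply: semidecidable_and; [apply: semidecidable_jump_set|]; semidecidability.
have [|h hh hP] := @smn_range (fun _ _ => true); first by semidecidability.
pose t n := primrec (h 0) (fun _ e => f (g e)) n; pose T n := jump_set A (t n).
(* Since [a] is not in [B], it is alone in its class for [B], and removing it keeps the set
   [B]-saturated. *)
have gB e : jump_set B (g e) = jump_set A e `\ a.
  rewrite /jump_set (gP e).1 saturate_id => [|y z [ye /eqP neq_ya] yz].
    by apply/seteqP; split=> z [ze /eqP].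
  split; last by case: yz neq_ya => [->/eqP//|[_ Bz] _]; apply: contra_notN nBa => /eqP <-.
  by apply: saturate_closed ye _; case: yz => [->|[/BA ? /BA ?]]; [left|right].
have hT C : jump_set C (h 0) = setT.
  rewrite /jump_set (hP 0).1; apply/seteqP; split=> // z _.
  by exists z; split=> //; left.
have strict n : T n.+1 `<=` T n /\ exists2 z, T n z & ~ T n.+1 z.
  elim: n => [|n [sub [z Tz nTz]]].
    split; rewrite /T /= hT //; apply: contrapT => no_z.
    have T1 : jump_set A (f (g (h 0))) = setT.
      by apply/seteqP; split=> // z _; apply: contrapT => nz; apply: no_z; exists z.
    (* If removing [a] from the full set still gave a full image, monotonicity would make the image
       of the full set full as well, against injectivity. *)
    have : fs_jump (eqrel_of A) (f (g (h 0))) (f (h 0)).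
      apply/fs_jumpP/seteqP; split; first by apply: mono; rewrite hT.
      rewrite T1; exact: subsetT.
    by move=> /fP/fs_jumpP; rewrite gB !hT => /seteqP[_ /(_ a I)[_ /(_ erefl)]].
  split; first by apply: mono; rewrite !gB; apply: setSD.
  apply: contrapT => no_z.
  have : fs_jump (eqrel_of A) (f (g (t n.+1))) (f (g (t n))).
    apply/fs_jumpP/seteqP; split; first by apply: mono; rewrite !gB; apply: setSD.
    by move=> y Ty; apply: contrapT => nTy; apply: no_z; exists y.
  move=> /fP/fs_jumpP; rewrite !gB => /seteqP[_ sub'].
  (* Injectivity leaves [a] as the only possible difference between [T n] and [T n.+1]. But
     [A]-saturated sets containing [a] contain [b] and conversely, and [b] was not removed. *)
  have [eq_za|neq_za] := eqVneq z a; last by have [] := sub' z (conj Tz (elimN eqP neq_za)).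
  apply: nTz; have [|Tb _] := sub' b.
    by split=> //; apply: saturate_closed Tz _; right; rewrite eq_za.
  by apply: saturate_closed Tb _; right; rewrite eq_za.
have desc m n z : T (m + n) z -> T m z.
  by elim: n => [|n IH]; rewrite ?addn0 // addnS => /(strict _).1/IH.
have sdT m : semidecidable (fun w => T (m + nleft w) (nright w)).
  by apply: semidecidable_jump_set => //; rewrite /t; computability.
(* If some [T m] misses [A], the tail from [m] has all its nonempty differences outside [A].
   Otherwise every [T m] meets [A], so by saturation contains it, and again no difference meets
   [A]. *)
have [[m disj]|meets] := pselect (exists m, forall z, T m z -> ~ A z).
  have [|n hn] := @maximal_no_descending_family A (fun n => T (m + n)) maxA (sdT m).
    by move=> n z; rewrite addnS => /(strict _).1.
  have [_ [z Tz nTz]] := strict (m + n).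
  by apply: (disj z); [apply: desc Tz|apply: hn => //; rewrite addnS].
have [|n hn] := @maximal_no_descending_family A T maxA (sdT 0).
  by move=> n z /(strict _).1.
have [_ [z Tz nTz]] := strict n; have Az := hn z Tz nTz.
apply: meets; exists n.+1 => y Ty Ay; apply: nTz.
by apply: saturate_closed Ty _; right.
Qed.

Theorem theorem4p8 (A B : set nat) (maxA : maximal A) (ceB : ce B)
    (ltBA : B `<` A) :
  strictly_reducible (fs_jump (eqrel_of A)) (fs_jump (eqrel_of B)) /\
  ~ high_for_fs_jump (eqrel_of A).
Proof.
have [ceA _ _] := maxA; have not_red := jump_not_reducible maxA ltBA.
split; first by split=> //; apply: jump_reducible_sub ceA ltBA.1.
(* If [E_A] were high, the jump of [B] would reduce to the jump of [A] through [eqce]. *)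
move=> [_ red]; apply: not_red.
exact: reducible_trans (jump_reducible_eqce ceB) red.
Qed.
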